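(* Let $\mathcal{X}$ and $\mathcal{V}$ be infinite sets (of alternatives and voters). There is no voting method $F$ (on profiles with alternatives from $\mathcal{X}$ and voters from $\mathcal{V}$) that simultaneously satisfies positive involvement, the Condorcet winner criterion, the Condorcet loser criterion, resolvability, and ordinal margin invariance. This holds whether resolvability is taken to mean single-voter resolvability or asymptotic resolvability.
   Context: A profile $\mathbf{P}$ is a function from a nonempty finite set $V(\mathbf{P})\subseteq\mathcal{V}$ (the voters of $\mathbf{P}$) to the set of strict weak orders on a nonempty finite set $X(\mathbf{P})\subseteq\mathcal{X}$ (the alternatives of $\mathbf{P}$); $(x,y)\in\mathbf{P}(i)$ means voter $i$ strictly prefers $x$ to $y$. The profile is linear if every $\mathbf{P}(i)$ is a linear order. For $x,y\in X(\mathbf{P})$, $\mathrm{Support}_\mathbf{P}(a,b)=|\{i\in V(\mathbf{P}) : (a,b)\in\mathbf{P}(i)\}|$ and $\mathrm{Margin}_\mathbf{P}(x,y)=\mathrm{Support}_\mathbf{P}(x,y)-\mathrm{Support}_\mathbf{P}(y,x)$. A voting method is a function $F$ assigning to every profile $\mathbf{P}$ a nonempty subset $F(\mathbf{P})\subseteq X(\mathbf{P})$. Positive involvement: for all profiles $\mathbf{P},\mathbf{P}'$, if $x\in F(\mathbf{P})$ and $\mathbf{P}'$ is obtained from $\mathbf{P}$ by adding one new voter whose ranking (over $X(\mathbf{P})$) places $x$ uniquely first, then $x\in F(\mathbf{P}')$. Condorcet winner criterion: whenever $\mathbf{P}$ has a Condorcet winner $x$ (i.e. $\mathrm{Margin}_\mathbf{P}(x,y)>0$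 for all $y\neq x$), $F(\mathbf{P})=\{x\}$. Condorcet loser criterion: $F(\mathbf{P})$ never contains a Condorcet loser, i.e. an $x$ with $\mathrm{Margin}_\mathbf{P}(y,x)>0$ for all $y\in X(\mathbf{P})\setminus\{x\}$. Single-voter resolvability: for every profile $\mathbf{P}$ with $|F(\mathbf{P})|>1$ there is a profile $\mathbf{P}'$ obtained from $\mathbf{P}$ by adding exactly one new voter such that $|F(\mathbf{P}')|=1$. Asymptotic resolvability: for every positive integer $m$, as the number $n$ of voters tends to infinity, the proportion of linear profiles with $m$ (fixed) alternatives and $n$ voters for which $|F(\mathbf{P})|>1$ tends to $0$. Ordinal margin graph: $\mathbb{M}(\mathbf{P})=(M,\succ)$ where $M$ is the directed graph on $X(\mathbf{P})$ with an edge $x\to y$ iff $\mathrm{Margin}_\mathbf{P}(x,y)>0$, and $\succ$ is the strict weak order on edges with $(a,b)\succ(c,d)$ iff $\mathrm{Margin}_\mathbf{P}(a,b)>\mathrm{Margin}_\mathbf{P}(c,d)$. Ordinal margin invariance: $\mathbb{M}(\mathbf{P})=\mathbb{M}(\mathbf{P}')$ implies $F(\mathbf{P})=F(\mathbf{P}')$. *)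

(* Defs.v *)
From HB Require Import structures.
From mathcomp Require Import all_boot all_order all_algebra.
From mathcomp Require Import finmap.
From mathcomp Require Import boolp.

Set Implicit Arguments.
Unset Strict Implicit.
Unset Printing Implicit Defensive.

Import Order.TTheory GRing.Theory Num.Theory.
Local Open Scope fset_scope.

Section Voting.
Variables (X V : choiceType).

Definition infinite_type (T : eqType) : Prop :=
  forall s : seq T, exists x : T, x \notin s.

(* Raw profile data: voters V(P), alternatives X(P), and preferences;
   ppref i x y = true means voter i strictly prefers x to y. *)
Record profile_data := ProfileData {
  pvoters : {fset V};
  palts : {fset X};
  ppref : V -> X -> X -> bool }.

Definition strict_weak_order_on (A : {fset X}) (R : X -> X -> bool) : Prop :=
  [/\ (forall x y, x \in A -> y \in A -> R x y -> ~~ R y x),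
      (forall x y z, x \in A -> y \in A -> z \in A -> R x y -> R y z -> R x z)
    & (forall x y z, x \in A -> y \in A -> z \in A -> R x z -> R x y || R y z)].

Definition linear_order_on (A : {fset X}) (R : X -> X -> bool) : Prop :=
  strict_weak_order_on A R /\
  (forall x y, x \in A -> y \in A -> x != y -> R x y || R y x).

(* Well-formedness: nonempty finite voter/alternative sets, each voter's
   relation is a strict weak order on X(P), and no junk outside V(P) x X(P)^2
   (so that a profile is determined exactly by the mathematical data). *)
Definition wf_profile (P : profile_data) : Prop :=
  [/\ pvoters P != fset0, palts P != fset0,
      (forall i x y, ppref P i x y ->
         [/\ i \in pvoters P, x \in palts P & y \in palts P])
    & (forall i, i \in pvoters P -> strict_weak_order_on (palts P) (ppref P i))].

Definition profile := {P : profile_data | wf_profile P}.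

Definition voters (P : profile) : {fset V} := pvoters (proj1_sig P).
Definition alts (P : profile) : {fset X} := palts (proj1_sig P).
Definition pref (P : profile) : V -> X -> X -> bool := ppref (proj1_sig P).

Definition linear_profile (P : profile) : Prop :=
  forall i, i \in voters P -> linear_order_on (alts P) (pref P i).

Definition support (P : profile) (a b : X) : nat :=
  #|` [fset i in voters P | pref P i a b] |.

Definition margin (P : profile) (x y : X) : int :=
  ((support P x y)%:Z - (support P y x)%:Z)%R.

Definition voting_method (F : profile -> {fset X}) : Prop :=
  forall P, F P `<=` alts P /\ F P != fset0.

Definition adds_voter (P P' : profile) (j : V) : Prop :=
  [/\ j \notin voters P, voters P' = j |` voters P, alts P' = alts P
    & forall i, i != j -> pref P' i = pref P i].

Definition positive_involvement (F : profile -> {fset X}) : Prop :=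
  forall (P P' : profile) (j : V) (x : X),
    x \in F P -> adds_voter P P' j ->
    (forall y, y \in alts P -> y != x -> pref P' j x y) ->
    x \in F P'.

Definition condorcet_winner (P : profile) (x : X) : Prop :=
  x \in alts P /\ forall y, y \in alts P -> y != x -> (0 < margin P x y)%R.

Definition condorcet_winner_criterion (F : profile -> {fset X}) : Prop :=
  forall P x, condorcet_winner P x -> F P = [fset x].

Definition condorcet_loser (P : profile) (x : X) : Prop :=
  [/\ x \in alts P, (exists y, y \in alts P /\ y != x)
    & forall y, y \in alts P -> y != x -> (0 < margin P y x)%R].

Definition condorcet_loser_criterion (F : profile -> {fset X}) : Prop :=
  forall P x, condorcet_loser P x -> x \notin F P.

Definition single_voter_resolvable (F : profile -> {fset X}) : Prop :=
  forall P, 1 < #|` F P| ->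
    exists (P' : profile) (j : V), adds_voter P P' j /\ #|` F P'| = 1.

Definition mg_edge (P : profile) (a b : X) : bool :=
  [&& a \in alts P, b \in alts P & (0 < margin P a b)%R].

Definition ordinal_margin_graph (P : profile)
  : {fset X} * (X -> X -> bool) * (X * X -> X * X -> bool) :=
  (alts P, mg_edge P,
   fun e1 e2 => [&& mg_edge P e1.1 e1.2, mg_edge P e2.1 e2.2 &
                    (margin P e2.1 e2.2 < margin P e1.1 e1.2)%R]).

Definition ordinal_margin_invariant (F : profile -> {fset X}) : Prop :=
  forall P P', ordinal_margin_graph P = ordinal_margin_graph P' -> F P = F P'.

(* Linear profiles with alternatives A and voters W, encoded injectively as
   finite tables g i x y = pref P i x y. *)
Definition encodes (A : {fset X}) (W : {fset V}) (P : profile)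
  (g : {ffun W -> {ffun A -> {ffun A -> bool}}}) : Prop :=
  [/\ alts P = A, voters P = W, linear_profile P
    & forall (i : W) (x y : A), pref P (val i) (val x) (val y) = g i x y].

Definition num_linear_profiles (A : {fset X}) (W : {fset V}) : nat :=
  #|[set g | `[< exists P, @encodes A W P g >] ]|.

Definition num_linear_unresolved (F : profile -> {fset X})
  (A : {fset X}) (W : {fset V}) : nat :=
  #|[set g | `[< exists P, @encodes A W P g /\ 1 < #|` F P| >] ]|.

Definition asymptotically_resolvable (F : profile -> {fset X}) : Prop :=
  forall m : nat, 0 < m ->
  forall A : {fset X}, #|` A| = m ->
  forall W : nat -> {fset V}, (forall n, #|` W n| = n) ->
  forall eps : rat, (0 < eps)%R ->
  exists N : nat, forall n : nat, N <= n ->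
    ((num_linear_unresolved F A (W n))%:R /
     (num_linear_profiles A (W n))%:R < eps)%R.

End Voting.

(* Main.v *)
Require Import Defs.
From HB Require Import structures.
From mathcomp Require Import all_boot all_order all_algebra.
From mathcomp Require Import finmap.
From mathcomp Require Import boolp.
From mathcomp Require Import zify ring lra.

(* Call a profile uniquely weighted if distinct pairs of distinct alternatives
   have distinct margins. Either form of resolvability makes [F P] a singleton
   for every uniquely weighted linear profile [P].
   - Single-voter: tripling every voter separates the margins by at least 3, so
     one further voter does not change the ordinal margin graph.
   - Asymptotic: a positive proportion of the linear profiles with [n] voters,
     for infinitely many [n], has the ordinal margin graph of [P]. Draw [n = k^2]
     ballots independently from the mixture (1 - C/k) uniform + (C/k) ballots of
     [P]. The expected margins are a multiple of order [k] of those of [P] while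
     the standard deviations are at most [k], so by Chebyshev's inequality the
     order of the margins is that of [P] with probability at least 3/4; and the
     second moment of the density with respect to the uniform measure is bounded
     in [n], so this event also has uniform probability bounded below.
   Ordinal margin invariance lets one choose margins freely within an ordinal
   margin graph, and positive involvement transports the win of [x] along the
   addition of ballots with [x] on top. Together with the two Condorcet criteria
   this forces the winners of explicit uniquely weighted profiles on four
   alternatives, and these are contradictory. *)

Set Implicit Arguments.
Unset Strict Implicit.
Unset Printing Implicit Defensive.

Import Order.TTheory GRing.Theory Num.Theory.

(** * Enumerating elements of an infinite type *)

Lemma infinite_type_inj (T : choiceType) :
  infinite_type T -> exists f : nat -> T, injective f.
Proof.
move=> infT; have [fresh freshP] := choice infT.
(* [s n] collects the first [n] chosen elements, and the next one is chosen outside it. *)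
pose s n := iter n (fun s => fresh s :: s) [::].
have sP m n : m < n -> fresh (s m) \in s n.
  elim: n => // n IHn; rewrite ltnS leq_eqVlt inE => /orP[/eqP ->|/IHn ->].
    by rewrite eqxx.
  by rewrite orbT.
exists (fresh \o s) => m n /= eq_mn; apply/eqP; move: eq_mn.
by case: ltngtP => // /sP + eq_mn; [rewrite eq_mn|rewrite -eq_mn];
  rewrite (negPf (freshP _)).
Qed.

Section Initial.
Local Open Scope fset_scope.
Variables (T : choiceType) (f : nat -> T) (f_inj : injective f).

Definition initial n : {fset T} := [fset f k | k in iota 0 n].

Lemma initialP n x : reflect (exists2 k, k < n & x = f k) (x \in initial n).
Proof.
apply: (iffP (imfsetP _ _ _ _)) => -[k].
  by rewrite mem_iota => /= ltkn ->; exists k.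
by move=> ltkn ->; exists k; rewrite //= mem_iota.
Qed.

Lemma mem_initial n k : (f k \in initial n) = (k < n).
Proof. by apply/initialP/idP => [[i ltin /f_inj ->]|]; last exists k. Qed.

Lemma card_initial n : #|` initial n| = n.
Proof. by rewrite card_imfset //= undup_id ?iota_uniq ?size_iota. Qed.

Lemma sum_initial n (F : T -> nat) :
  \sum_(i <- initial n) F i = \sum_(0 <= k < n) F (f k).
Proof.
rewrite big_imfset /=; last by move=> i j _ _; exact: f_inj.
by rewrite undup_id ?iota_uniq // /index_iota subn0.
Qed.

End Initial.

(** * Margins, and profiles given by enumerated ballots *)

Section Profiles.
Local Open Scope fset_scope.
Variables X V : choiceType.
Implicit Types (P : profile X V) (A : {fset X}) (F : profile X V -> {fset X}).

Lemma supportE P a b : Defs.support P a b = \sum_(i <- voters P) pref P i a b.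
Proof.
rewrite /Defs.support card_fset_sum1.
transitivity (\sum_(i <- voters P | pref P i a b) 1).
  by rewrite [RHS]big_fset_condE.
by rewrite big_mkcond; apply: eq_bigr => i _; case: pref.
Qed.

Lemma margin_diag P a : margin P a a = 0%R.
Proof. by rewrite /margin subrr. Qed.

Lemma marginC P a b : margin P b a = (- margin P a b)%R.
Proof. by rewrite /margin opprB. Qed.

(** Diagonal margins are 0, so comparison with a diagonal pair decides the sign of a margin. The
    order of all margins thus fixes the edges as well as their ranking. *)
Lemma margin_order_invariant F P P' : ordinal_margin_invariant F ->
  alts P = alts P' ->
  (forall x y z w, x \in alts P -> y \in alts P -> z \in alts P ->
     w \in alts P -> (margin P x y < margin P z w)%R =
                     (margin P' x y < margin P' z w)%R) ->
  F P = F P'.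
Proof.
move=> oF eqA eqm; apply: oF.
have eqe a b : mg_edge P a b = mg_edge P' a b.
  rewrite /mg_edge -eqA; case aA: (a \in _) => //=; case bA: (b \in _) => //=.
  by have := eqm a a a b; rewrite !margin_diag => ->.
rewrite /ordinal_margin_graph -eqA; congr (_, _, _).
  by apply/funext => a; apply/funext => b.
apply/funext => -[a b]; apply/funext => -[c d] /=; rewrite -!eqe.
rewrite /mg_edge; case aA: (a \in _) => //=; case bA: (b \in _) => //=.
case cA: (c \in _) => //=; case dA: (d \in _) => //=; first by rewrite eqm.
Qed.

Definition uniquely_weighted P := forall x y z w,
  x \in alts P -> y \in alts P -> z \in alts P -> w \in alts P ->
  x != y -> z != w -> margin P x y = margin P z w -> x = z /\ y = w.

Lemma adds_voter_margin P P' j a b : adds_voter P P' j ->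
  margin P' a b = (margin P a b + (pref P' j a b)%:Z - (pref P' j b a)%:Z)%R.
Proof.
case=> jP vP' _ prefP'.
have sE c d : Defs.support P' c d = (pref P' j c d + Defs.support P c d)%N.
  rewrite !supportE vP' big_fsetU1 //=; congr (_ + _)%N.
  rewrite big_seq [RHS]big_seq; apply: eq_bigr => i iP.
  by rewrite prefP' //; apply: contraNneq jP => <-.
by rewrite /margin !sE !PoszD; lia.
Qed.

Definition good_ballot A (r : X -> X -> bool) :=
  (forall x y, r x y -> x \in A /\ y \in A) /\ strict_weak_order_on A r.

Section Enumerated.
Variables (v : nat -> V) (v_inj : injective v).

(** Searching for the index of [i] inverts [v] on the first [n] voters and leaves the relation empty
    for everyone else, as [wf_profile] demands. *)
Definition enum_data A n (b : nat -> X -> X -> bool) : profile_data X V :=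
  ProfileData (initial v n) A
    (fun i x y => has (fun k => (v k == i) && b k x y) (iota 0 n)).

Lemma enum_profile A n b : A != fset0 -> 0 < n -> (forall k, good_ballot A (b k)) ->
  exists P, [/\ alts P = A, voters P = initial v n &
    forall k, k < n -> pref P (v k) = b k].
Proof.
move=> A0 n0 gb.
have prefE k x y : k < n -> ppref (enum_data A n b) (v k) x y = b k x y.
  move=> ltkn /=; apply/hasP/idP => [[l _ /andP[/eqP/v_inj ->]]//|bkxy].
  by exists k; rewrite ?mem_iota ?eqxx.
have wf : wf_profile (enum_data A n b).
  split=> //=.
  - by rewrite -cardfs_gt0 (card_initial v_inj).
  - move=> i x y /hasP[k kn /andP[/eqP <- /(proj1 (gb k))[xA yA]]].
    by split=> //; apply/initialP; exists k; rewrite // mem_iota in kn.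
  - move=> i /initialP[k ltkn ->].
    have -> : (fun x y => has (fun l => (v l == v k) && b l x y) (iota 0 n)) = b k.
      by apply/funext => x; apply/funext => y; exact: prefE.
    exact: (proj2 (gb k)).
exists (exist _ _ wf); split=> // k ltkn.
by apply/funext => x; apply/funext => y; exact: prefE.
Qed.

Lemma enum_support P n b x y : voters P = initial v n ->
  (forall k, k < n -> pref P (v k) = b k) ->
  Defs.support P x y = \sum_(0 <= k < n) b k x y.
Proof.
move=> vP bP; rewrite supportE vP (sum_initial v_inj) big_nat [RHS]big_nat.
by apply: eq_bigr => k /= /bP ->.
Qed.

End Enumerated.
End Profiles.

(** * Single-voter resolvability *)

Lemma sum_nat_modn (f : nat -> nat) c n :
  \sum_(0 <= k < c * n) f (k %% n) = c * \sum_(0 <= k < n) f k.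
Proof.
elim: c => [|c IHc]; first by rewrite !mul0n big_nil.
rewrite mulSnr (big_cat_nat (n := c * n)) ?leq_addr //= IHc mulSnr.
congr addn; rewrite -{1}[c * n]add0n big_addn addKn.
rewrite big_nat [RHS]big_nat; apply: eq_bigr => k /andP[_ ltkn].
by rewrite addnC modnMDl modn_small.
Qed.

Section SingleVoter.
Variables X V : choiceType.
Implicit Types (P : profile X V) (F : profile X V -> {fset X}).

Lemma alts_neq0 P : alts P != fset0.
Proof. by case: (proj2_sig P). Qed.

Lemma voters_neq0 P : voters P != fset0.
Proof. by case: (proj2_sig P). Qed.

Lemma pref_alts P i x y : pref P i x y -> x \in alts P /\ y \in alts P.
Proof. by case: (proj2_sig P) => _ _ H _ /H[]. Qed.

Lemma pref_good P i : i \in voters P -> good_ballot (alts P) (pref P i).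
Proof.
move=> iP; split; first exact: pref_alts.
by case: (proj2_sig P) => _ _ _; apply.
Qed.

(** The copies need new names, so the electorate is rebuilt from an enumeration of [V]: [v k]
    receives the ballot of the original voter at position [k %% n]. *)
Lemma replicate_profile (infV : infinite_type V) P c : 0 < c ->
  exists P', alts P' = alts P /\
    forall x y, margin P' x y = (c%:Z * margin P x y)%R.
Proof.
move=> c0; have [v v_inj] := infinite_type_inj infV.
have /fset0Pn[i0 i0P] := voters_neq0 P.
pose s : seq V := voters P; pose n := size s.
have n0 : 0 < n by rewrite /n cardfs_gt0 voters_neq0.
pose b k := pref P (nth i0 s (k %% n)).
have gb k : good_ballot (alts P) (b k).
  by apply: pref_good; apply: (@mem_nth _ i0 s); rewrite ltn_mod.
have cn0 : 0 < c * n by rewrite muln_gt0 c0.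
have [P' [aP' vP' bP']] := enum_profile v_inj (alts_neq0 P) cn0 gb.
exists P'; split=> // x y.
have sE z w : Defs.support P' z w = (c * Defs.support P z w)%N.
  rewrite (enum_support v_inj _ _ vP' bP').
  rewrite (sum_nat_modn (fun k => pref P (nth i0 s k) z w : nat)) supportE.
  by congr muln; rewrite [in RHS](big_nth i0).
by rewrite /margin !sE !PoszM mulrBr.
Qed.

(** A zero margin between distinct alternatives would equal its own converse, against unique
    weighting. So zero margins occur only on the diagonal. *)
Lemma uniquely_weighted_eq P x y z w : uniquely_weighted P ->
  x \in alts P -> y \in alts P -> z \in alts P -> w \in alts P ->
  margin P x y = margin P z w -> (x = z /\ y = w) \/ (x = y /\ z = w).
Proof.
move=> uP xP yP zP wP.
have neq0 a b : a \in alts P -> b \in alts P -> margin P a b = 0%R -> a = b.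
  move=> aP bP m0; apply/eqP/negPn/negP => ab.
  have [||eqab _] := uP a b b a aP bP bP aP ab; first by rewrite eq_sym.
    by rewrite (marginC P a b) m0 oppr0.
  by rewrite eqab eqxx in ab.
have [->|xy] := eqVneq x y.
  by rewrite margin_diag => /esym/neq0 ->; [right|..].
have [->|zw] := eqVneq z w.
  by rewrite margin_diag => /neq0 eqxy; rewrite eqxy ?eqxx in xy.
by move=> /uP; left; auto.
Qed.

Lemma single_voter_uniquely_weighted F P : infinite_type V ->
  ordinal_margin_invariant F -> single_voter_resolvable F ->
  uniquely_weighted P -> #|` F P| <= 1.
Proof.
move=> infV oF rF uP; rewrite leqNgt; apply/negP => gt1.
have [P3 [aP3 mP3]] := replicate_profile infV P (isT : 0 < 3).
have FP3 : F P3 = F P.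
  by apply: margin_order_invariant => // x y z w _ _ _ _; rewrite !mP3; lia.
rewrite -FP3 in gt1; have [P' [j [jP' card1]]] := rF _ gt1.
have aP' : alts P' = alts P by case: jP' => _ _ -> _.
suff FP' : F P = F P' by rewrite FP3 FP' card1 in gt1.
apply: margin_order_invariant => // x y z w xP yP zP wP.
rewrite !(adds_voter_margin _ _ jP') !mP3.
have [eqm|neqm] := eqVneq (margin P x y) (margin P z w).
  have [[-> ->]|[-> ->]] := uniquely_weighted_eq uP xP yP zP wP eqm; first by lia.
  by rewrite !margin_diag; lia.
(* Distinct tripled margins differ by at least 3 and one ballot shifts each by at most 1, so their
   order survives. *)
case: (pref P' j x y); case: (pref P' j y x);
  case: (pref P' j z w); case: (pref P' j w z); lia.
Qed.
End SingleVoter.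

(** * Product measures *)

Section ProductMeasure.
Local Open Scope ring_scope.
Variables (R : realFieldType) (I T : finType) (q : T -> R).
Hypotheses (q_ge0 : forall t, 0 <= q t) (q_sum1 : \sum_t q t = 1).

Definition weight (g : {ffun I -> T}) : R := \prod_i q (g i).

Lemma weight_ge0 g : 0 <= weight g.
Proof. exact: prodr_ge0. Qed.

Lemma sum_weight : \sum_g weight g = 1.
Proof.
by rewrite -(bigA_distr_bigA (fun _ t => q t)) /= big1 // => i _; exact: q_sum1.
Qed.

Lemma sum_weight_sqr : \sum_g weight g ^+ 2 = (\sum_t q t ^+ 2) ^+ #|I|.
Proof.
rewrite (eq_bigr (fun g : {ffun I -> T} => \prod_i q (g i) ^+ 2)).
  by rewrite -(bigA_distr_bigA (fun _ t => q t ^+ 2)) /= prodr_const.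
by move=> g _; rewrite prodrXl.
Qed.

Lemma sum_weight_pair (h : T -> R) i j : \sum_t q t * h t = 0 ->
  \sum_g weight g * (h (g i) * h (g j)) =
  if i == j then \sum_t q t * h t ^+ 2 else 0.
Proof.
(* Attaching the factors [h] to the coordinates [i] and [j] makes the summand a product over
   coordinates, so the sum factors. For distinct [i] and [j] the factor at [i] is the mean of [h],
   which is 0. *)
move=> h0; pose f k t :=
  q t * ((if k == i then h t else 1) * (if k == j then h t else 1)).
rewrite (eq_bigr (fun g : {ffun I -> T} => \prod_k f k (g k))); last first.
  by move=> g _; rewrite !big_split /= -!big_mkcond !big_pred1_eq.
rewrite -(bigA_distr_bigA f) (bigD1 i) //=.
have [eij|ij] := eqVneq i j.
  subst j.
  rewrite [X in _ * X]big1 ?mulr1.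
    by apply: eq_bigr => t _; rewrite /f eqxx expr2.
  move=> k ki; rewrite -[RHS]q_sum1; apply: eq_bigr => t _.
  by rewrite /f (negPf ki) !mulr1.
rewrite [X in X * _](_ : _ = 0) ?mul0r // -[RHS]h0; apply: eq_bigr => t _.
by rewrite /f eqxx (negPf ij) mulr1.
Qed.

Lemma sum_weight_variance (h : T -> R) : \sum_t q t * h t = 0 ->
  \sum_g weight g * (\sum_i h (g i)) ^+ 2 = #|I|%:R * \sum_t q t * h t ^+ 2.
Proof.
move=> h0; rewrite (eq_bigr (fun g : {ffun I -> T} =>
    \sum_i \sum_j weight g * (h (g i) * h (g j)))); last first.
  move=> g _; rewrite expr2 mulr_suml mulr_sumr; apply: eq_bigr => i _.
  by rewrite mulr_sumr mulr_sumr.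
rewrite exchange_big /= (eq_bigr (fun=> \sum_t q t * h t ^+ 2)).
  by rewrite sumr_const mulr_natl.
move=> i _; rewrite exchange_big /= (bigD1 i) //= sum_weight_pair // eqxx.
rewrite [X in _ + X]big1 ?addr0 // => j ji.
by rewrite sum_weight_pair // eq_sym (negPf ji).
Qed.

Lemma weight_chebyshev (h : T -> R) (mu d : R) : (forall t, `|h t| <= 1) ->
  \sum_t q t * h t = mu -> 0 < d ->
  d ^+ 2 * \sum_(g : {ffun I -> T} | d <= `|\sum_i h (g i) - #|I|%:R * mu|) weight g
    <= #|I|%:R.
Proof.
move=> h1 hmu d0; pose h' t := h t - mu.
have h'0 : \sum_t q t * h' t = 0.
  rewrite /h'; under eq_bigr do rewrite mulrBr.
  by rewrite sumrB hmu -mulr_suml q_sum1 mul1r subrr.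
have var1 : \sum_t q t * h' t ^+ 2 <= 1.
  have -> : \sum_t q t * h' t ^+ 2 = \sum_t q t * h t ^+ 2 - mu ^+ 2.
    transitivity (\sum_t (q t * h t ^+ 2 + (q t * h t * (- mu *+ 2) + q t * mu ^+ 2))).
      by apply: eq_bigr => t _; rewrite /h'; ring.
    rewrite !big_split /= -!mulr_suml hmu q_sum1; ring.
  apply: le_trans (_ : \sum_t q t * h t ^+ 2 <= 1).
    by rewrite gerBl sqr_ge0.
  rewrite -q_sum1; apply: ler_sum => t _; rewrite ler_piMr //.
  by rewrite -real_normK ?num_real // expr_le1.
have eqS (g : {ffun I -> T}) :
    \sum_i h (g i) - #|I|%:R * mu = \sum_i h' (g i).
  by rewrite sumrB sumr_const mulr_natl.
apply: le_trans (_ : #|I|%:R * \sum_t q t * h' t ^+ 2 <= _); last first.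
  by rewrite ler_piMr.
rewrite -(sum_weight_variance h'0) mulr_sumr big_mkcond /=.
apply: ler_sum => g _; rewrite eqS; case: ifP => [dS|_]; last first.
  by rewrite mulr_ge0 ?weight_ge0 ?sqr_ge0.
rewrite mulrC ler_wpM2l ?weight_ge0 //.
by rewrite -[leRHS]real_normK ?num_real // ler_sqr ?nnegrE // ltW.
Qed.

(** Union bound: by Chebyshev the deviations have total mass at most 1/4 over all [j], and a table
    with an entry outside [L] has weight 0. *)
Lemma weight_typical (J : finType) (L : {set T}) (h : J -> T -> R)
    (mu : J -> R) (d : R) :
  (forall t, t \notin L -> q t = 0) -> (forall j t, `|h j t| <= 1) ->
  (forall j, \sum_t q t * h j t = mu j) -> 0 < d ->
  (4 * #|J| * #|I|)%:R <= d ^+ 2 ->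
  3 / 4 <= \sum_(g : {ffun I -> T} | (g \in ffun_on (mem L)) &&
     [forall j, `|\sum_i h j (g i) - #|I|%:R * mu j| < d]) weight g.
Proof.
move=> qL h1 hmu d0 dJ; set good := (X in \sum_(g | X g) _).
pose bad j (g : {ffun I -> T}) := d <= `|\sum_i h j (g i) - #|I|%:R * mu j|.
have le_bad : \sum_j \sum_(g | bad j g) weight g <= 4^-1.
  have d2 : 0 < d ^+ 2 by rewrite exprn_gt0.
  rewrite -(ler_pM2l d2) mulr_sumr.
  apply: le_trans (_ : \sum_(j : J) #|I|%:R <= _).
    by apply: ler_sum => j _; exact: weight_chebyshev.
  by move: dJ; rewrite sumr_const -[_ *+ _]mulr_natl !natrM; lra.
suff : 1 <= \sum_(g | good g) weight g + \sum_j \sum_(g | bad j g) weight g by lra.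
rewrite -sum_weight [X in _ <= _ + X](eq_bigr (fun j =>
    \sum_g if bad j g then weight g else 0)); last by move=> j _; rewrite big_mkcond.
rewrite exchange_big /= [X in _ <= X + _]big_mkcond -big_split /=; apply: ler_sum => g _.
have bad_ge0 : 0 <= \sum_j (if bad j g then weight g else 0).
  by apply: sumr_ge0 => j _; case: ifP => // _; exact: weight_ge0.
case: ifP => [_|]; first by rewrite lerDl.
rewrite add0r => /negbT; rewrite negb_and.
move=> /orP[/ffun_onP/existsNP[i /negP giL]|/forallPn[j]].
  by apply: le_trans bad_ge0; rewrite /weight (bigD1 i) //= qL // mul0r.
rewrite -leNgt => badj; rewrite (bigD1 j) //= /bad badj lerDl.
by apply: sumr_ge0 => k _; case: ifP => // _; exact: weight_ge0.
Qed.

(* AM-GM: [w <= (l + w ^+ 2 / l) / 2] bounds the mass of [B] by [#|B|] and the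
   second moment of the density. *)
Lemma card_ge_of_weight (B : {pred {ffun I -> T}}) (l : R) : 0 < l ->
  (\sum_t q t ^+ 2) ^+ #|I| <= l -> 3 / 4 <= \sum_(g in B) weight g ->
  1 <= 2 * l * #|B|%:R.
Proof.
move=> l0 sq_le BQ.
have : \sum_(g in B) weight g <= #|B|%:R * l / 2 + 1 / 2.
  apply: le_trans (_ : \sum_(g in B) (l / 2 + weight g ^+ 2 / l / 2) <= _).
    apply: ler_sum => g _; rewrite -mulrDl ler_pdivlMr //.
    rewrite -(ler_pM2l l0) [l * (l + _)]mulrDr [l * (_ / l)]mulrC divfK ?gt_eqF //.
    have := sqr_ge0 (weight g - l); nra.
  rewrite big_split /= sumr_const -!mulr_suml -[_ *+ #|_|]mulr_natl mulrA lerD2l.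
  rewrite ler_pM2r ?invr_gt0 // ler_pdivrMr // mul1r.
  apply: le_trans sq_le; rewrite -sum_weight_sqr.
  by rewrite big_mkcond; apply: ler_sum => g _; case: ifP => // _; exact: sqr_ge0.
by move: BQ; set S := \sum_(g in B) _; lra.
Qed.

End ProductMeasure.

(** It bounds the power uniformly in [n] once [n%:R * x] is fixed below 1; the value 1/2 gives the
    bound 2. *)
Lemma expr1D_bernoulli (R : realFieldType) (x : R) n : (0 <= x)%R ->
  ((1 + x) ^+ n * (1 - n%:R * x) <= 1)%R.
Proof.
move=> x0; elim: n => [|n IHn]; first by rewrite expr0 mul0r subr0 mulr1.
apply: le_trans IHn; rewrite exprSr -mulrA ler_wpM2l ?exprn_ge0 ?addr_ge0 //.
rewrite -natr1; have : (0 <= n%:R * x ^+ 2)%R by rewrite mulr_ge0 ?sqr_ge0.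
have := sqr_ge0 x; nra.
Qed.

(** * Asymptotic resolvability *)

Section Tables.
Local Open Scope fset_scope.
Variables (X V : choiceType) (A : {fset X}).

Notation table := {ffun A -> {ffun A -> bool}}.

Definition table_rel (t : table) (x y : X) : bool :=
  if insub x is Some a then if insub y is Some b then t a b else false else false.

Definition tabulate (r : X -> X -> bool) : table :=
  [ffun a => [ffun b => r (val a) (val b)]].

Definition linear_tables : {set table} :=
  [set t | `[< linear_order_on A (table_rel t) >]].

Lemma table_relE (t : table) (a b : A) : table_rel t (val a) (val b) = t a b.
Proof. by rewrite /table_rel !valK. Qed.

Lemma linear_order_on_ext (r r' : X -> X -> bool) :
  (forall x y, x \in A -> y \in A -> r x y = r' x y) ->
  linear_order_on A r -> linear_order_on A r'.
Proof.
move=> rr' [[asym trans wk] tot]; split; first split.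
- by move=> x y xA yA; rewrite -!rr' //; exact: asym.
- by move=> x y z xA yA zA; rewrite -!rr' //; exact: trans.
- by move=> x y z xA yA zA; rewrite -!rr' //; exact: wk.
- by move=> x y xA yA; rewrite -!rr' //; exact: tot.
Qed.

Lemma tabulate_linear (r : X -> X -> bool) (t : table) :
  (forall a b : A, r (val a) (val b) = t a b) ->
  linear_order_on A r -> t \in linear_tables.
Proof.
move=> rt rlin; rewrite inE; apply/asboolP; apply: linear_order_on_ext rlin.
by move=> x y xA yA; rewrite (rt [` xA] [` yA]) -table_relE.
Qed.

Definition converse (t : table) : table := [ffun a => [ffun b => t b a]].

Lemma converseK : involutive converse.
Proof. by move=> t; apply/ffunP => a; apply/ffunP => b; rewrite !ffunE. Qed.

Lemma converse_linear t : (converse t \in linear_tables) = (t \in linear_tables).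
Proof.
suff impl s : s \in linear_tables -> converse s \in linear_tables.
  by apply/idP/idP => /impl //; rewrite converseK.
rewrite inE => /asboolP[[asym trans wk] tot].
apply: (@tabulate_linear (fun x y => table_rel s y x)) => [a b|].
  by rewrite !ffunE table_relE.
split; first split.
- by move=> x y xA yA; exact: asym.
- by move=> x y z xA yA zA sxy syz; exact: trans syz sxy.
- by move=> x y z xA yA zA /(wk _ _ _ zA yA xA); rewrite orbC.
- by move=> x y xA yA; rewrite eq_sym; exact: tot.
Qed.

Lemma encodes_linear (W : {fset V}) P (g : {ffun W -> table}) :
  encodes P g -> g \in ffun_on (mem linear_tables).
Proof.
move=> [aP vP linP gP]; apply/ffun_onP => i.
apply: (tabulate_linear (gP i)); rewrite -aP.
by apply: linP; rewrite vP; exact: valP.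
Qed.

Lemma encodes_ex (W : {fset V}) (g : {ffun W -> table}) :
  A != fset0 -> W != fset0 -> g \in ffun_on (mem linear_tables) ->
  exists P, encodes P g.
Proof.
move=> A0 W0 /ffun_onP gL.
pose r (i : V) x y := if insub i is Some j then table_rel (g j) x y else false.
have rE (i : W) x y : r (val i) x y = table_rel (g i) x y by rewrite /r valK.
have rlin i : i \in W -> linear_order_on A (r i).
  move=> iW; have := gL [` iW]; rewrite inE => /asboolP.
  by apply: linear_order_on_ext => x y _ _; rewrite -rE.
have wf : wf_profile (ProfileData W A r).
  split=> //= [i x y|i /rlin[]//].
  rewrite /r; case: insubP => // j iW _; rewrite /table_rel.
  by case: insubP => // a xA _; case: insubP.
exists (exist _ _ wf); split=> //= i x y.
by rewrite /pref /= rE table_relE.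
Qed.

Lemma encodes_margin (W : {fset V}) P (g : {ffun W -> table}) (a b : A) :
  encodes P g ->
  ((margin P (val a) (val b))%:~R = \sum_i ((g i a b)%:R - (g i b a)%:R) :> rat)%R.
Proof.
move=> [_ vP _ gP].
have sE (c e : A) : Defs.support P (val c) (val e) = \sum_i g i c e.
  by rewrite supportE vP big_seq_fsetE; apply: eq_bigr => i _; rewrite gP.
by rewrite /margin !sE intrB -!pmulrn !natr_sum sumrB.
Qed.

End Tables.

(** * Ballots drawn from a perturbed uniform distribution *)

Section Asymptotic.
Local Open Scope ring_scope.
Variables (X V : choiceType) (P : profile X V).
Hypothesis linP : linear_profile P.

Let A := alts P.
Let T : finType := {ffun A -> {ffun A -> bool}}.
Let L : {set T} := linear_tables A.
Let U := voters P.
Let ballot (i : U) : T := tabulate A (pref P (val i)).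

Let diff (j : A * A) (t : T) : rat := (t j.1 j.2)%:R - (t j.2 j.1)%:R.

Let N0 : nat := #|{: U}|.
Let m : nat := #|{: A}|.

Let N0_gt0 : (0 < N0)%N.
Proof. by rewrite /N0 -cardfE cardfs_gt0 voters_neq0. Qed.

Let m_gt0 : (0 < m)%N.
Proof. by rewrite /m -cardfE cardfs_gt0 alts_neq0. Qed.

Let ballotL i : ballot i \in L.
Proof.
apply: (@tabulate_linear _ _ (pref P (val i))) => [a b|]; first by rewrite !ffunE.
by apply: linP; exact: valP.
Qed.

Let L_gt0 : (0 < #|L|)%N.
Proof. by case/card_gt0P: N0_gt0 => i _; apply/card_gt0P; exists (ballot i). Qed.

Let unif (t : T) : rat := (t \in L)%:R / #|L|%:R.
Let empir (t : T) : rat := (\sum_i (ballot i == t)%:R) / N0%:R.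

Let sum_unif e : \sum_t unif t * e t = (\sum_(t in L) e t) / #|L|%:R.
Proof.
rewrite [in RHS]big_mkcond mulr_suml; apply: eq_bigr => t _.
by rewrite /unif; case: (t \in L); rewrite ?mul0r // mul1r mulrC.
Qed.

Let sum_empir e : \sum_t empir t * e t = (\sum_i e (ballot i)) / N0%:R.
Proof.
rewrite [RHS]mulr_suml (eq_bigr (fun t => \sum_i (ballot i == t)%:R * (e t / N0%:R))).
  rewrite exchange_big; apply: eq_bigr => i _; rewrite (bigD1 (ballot i)) //=.
  rewrite eqxx mul1r big1 ?addr0 // => t; rewrite eq_sym => /negPf ->.
  by rewrite mul0r.
by move=> t _; rewrite /empir -mulr_suml; rewrite -!mulrA; congr (_ * _); rewrite mulrC.
Qed.

Let L_unit : #|L|%:R != 0 :> rat.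
Proof. by rewrite pnatr_eq0 -lt0n. Qed.

Let N0_unit : N0%:R != 0 :> rat.
Proof. by rewrite pnatr_eq0 -lt0n. Qed.

Let unif_ge0 t : 0 <= unif t.
Proof. by rewrite divr_ge0. Qed.

Let empir_ge0 t : 0 <= empir t.
Proof. by rewrite divr_ge0 // sumr_ge0. Qed.

Let unif_sum1 : \sum_t unif t = 1.
Proof.
have := sum_unif (fun=> 1); rewrite sumr_const divff // => <-.
by apply: eq_bigr => t _; rewrite mulr1.
Qed.

Let empir_sum1 : \sum_t empir t = 1.
Proof.
have := sum_empir (fun=> 1); rewrite sumr_const divff // => <-.
by apply: eq_bigr => t _; rewrite mulr1.
Qed.

Let empir_le1 t : empir t <= 1.
Proof. by rewrite -empir_sum1 (bigD1 t) //= lerDl sumr_ge0. Qed.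

Let sum_empir_unif : \sum_t empir t * unif t = #|L|%:R^-1.
Proof.
rewrite sum_empir (eq_bigr (fun=> #|L|%:R^-1)); last first.
  by move=> i _; rewrite /unif ballotL mul1r.
by rewrite sumr_const -[_ *+ _]mulr_natl mulrAC divff ?mul1r.
Qed.

(** Reversing all orders permutes the linear orders and negates [diff j]. *)
Let unif_diff j : \sum_t unif t * diff j t = 0.
Proof.
rewrite sum_unif sumrB; apply/eqP; rewrite mulf_eq0 subr_eq0; apply/orP; left.
rewrite (reindex_inj (inv_inj (@converseK X A))) /=; apply/eqP/eq_big => t.
  exact: converse_linear.
by move=> _; rewrite !ffunE.
Qed.

Let empir_diff j :
  \sum_t empir t * diff j t = (margin P (val j.1) (val j.2))%:~R / N0%:R.
Proof.
rewrite sum_empir; congr (_ / _).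
have /encodes_margin -> // : encodes P [ffun i : U => ballot i].
  by split=> // i a b; rewrite !ffunE.
by apply: eq_bigr => i _; rewrite /diff !ffunE.
Qed.

Let mix (th : rat) t := (1 - th) * unif t + th * empir t.

Let mix_sum th e : \sum_t mix th t * e t =
  (1 - th) * \sum_t unif t * e t + th * \sum_t empir t * e t.
Proof.
rewrite !mulr_sumr -big_split; apply: eq_bigr => t _ /=.
by rewrite /mix mulrDl !mulrA.
Qed.

(** The ballots of [P] lie in [L], so the cross term is exactly [2 * th * (1 - th) / #|L|] and the
    terms linear in [th] cancel. A perturbation of order [1/k] therefore stays bounded over [k^2]
    voters. *)
Let mix_sqr th : 0 <= th <= 1 ->
  \sum_t mix th t ^+ 2 <= (1 + th ^+ 2 * #|L|%:R) / #|L|%:R.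
Proof.
move=> /andP[th0 th1]; have Lpos : 0 < #|L|%:R :> rat by rewrite ltr0n.
have -> : \sum_t mix th t ^+ 2 = (1 - th) ^+ 2 * \sum_t unif t * unif t +
    2 * th * (1 - th) * \sum_t empir t * unif t + th ^+ 2 * \sum_t empir t ^+ 2.
  by rewrite !mulr_sumr -!big_split; apply: eq_bigr => t _ /=; rewrite /mix; ring.
have -> : \sum_t unif t * unif t = #|L|%:R^-1.
  rewrite sum_unif (eq_bigr (fun=> #|L|%:R^-1)) => [|t tL]; last first.
    by rewrite /unif tL mul1r.
  by rewrite sumr_const -[_ *+ _]mulr_natl divff ?mul1r.
rewrite sum_empir_unif [leRHS]mulrDl mulfK // mul1r.
have e1 : \sum_t empir t ^+ 2 <= 1.
  rewrite -empir_sum1; apply: ler_sum => t _; rewrite expr2.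
  exact: ler_piMr.
have : 0 < #|L|%:R^-1 :> rat by rewrite invr_gt0.
have := sqr_ge0 th; move: (\sum_t _) e1 (#|L|%:R^-1) => E E1 l; nra.
Qed.

(** With [th = 4 m N0 / k] this makes [th^2 * #|L|] equal to [D / k^2]. *)
Let D : nat := ((4 * m * N0) ^ 2 * #|L|)%N.

Definition close_margins (W : {fset V}) (d : rat) (g : {ffun W -> T}) : bool :=
  [forall j : A * A,
    `|\sum_i diff j (g i) - 2 * d * (margin P (val j.1) (val j.2))%:~R : rat| < d].

Lemma card_close_margins (W : {fset V}) s : (0 < s)%N ->
  #|{: W}| = ((2 * D * s) ^ 2)%N -> exists2 d : rat, 0 < d &
  #|L|%:R ^+ #|{: W}| <= 2 * 4 ^+ D *
    #|[pred g : {ffun W -> T} | (g \in ffun_on (mem L)) && close_margins d g]|%:R :> rat.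
Proof.
set k := (2 * D * s)%N => s0 cardI.
have D0 : (0 < D)%N by rewrite muln_gt0 expn_gt0 !muln_gt0 m_gt0 N0_gt0 L_gt0.
have k0 : (0 < k)%N by rewrite muln_gt0 s0 (muln_gt0 2) D0.
have kpos : 0 < k%:R :> rat by rewrite ltr0n.
have kneq0 : k%:R != 0 :> rat by rewrite gt_eqF.
(* Over [k^2] ballots the mean margins become [4 m k = 2 d] times those of [P], and
   [d^2 = 4 m^2 k^2] is exactly what Chebyshev requires for [m^2] pairs. The factor [D] in [k]
   ensures [th <= 1]. *)
pose th : rat := (4 * m * N0)%:R / k%:R.
have th01 : 0 <= th <= 1.
  rewrite divr_ge0 //= ler_pdivrMr // mul1r ler_nat /k /D.
  rewrite (_ : _ * s = 4 * m * N0 * (2 * (4 * m * N0) * #|L| * s))%N; last by ring.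
  by rewrite leq_pmulr // !muln_gt0 m_gt0 N0_gt0 L_gt0.
pose d : rat := (2 * m * k)%:R.
have d0 : 0 < d by rewrite ltr0n muln_gt0 k0 muln_gt0 m_gt0.
exists d => //.
have mix_ge0 t : 0 <= mix th t.
  case/andP: th01 => th0 th1; apply: addr_ge0; apply: mulr_ge0 => //.
  by rewrite subr_ge0.
have mix1 : \sum_t mix th t = 1.
  by rewrite big_split /= -!mulr_sumr unif_sum1 empir_sum1; ring.
have mixL t : t \notin L -> mix th t = 0.
  move=> tL; rewrite /mix /unif /empir (negPf tL) mul0r mulr0 add0r big1 ?mul0r ?mulr0 //.
  by move=> i _; case: eqP => // bt; rewrite -bt ballotL in tL.
have diff1 j t : `|diff j t| <= 1 by rewrite /diff; case: (t _ _); case: (t _ _).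
have mixd j : \sum_t mix th t * diff j t =
    th * ((margin P (val j.1) (val j.2))%:~R / N0%:R).
  by rewrite mix_sum unif_diff empir_diff mulr0 add0r.
have dJ : (4 * #|{: A * A}| * #|{: W}|)%:R <= d ^+ 2.
  rewrite -natrX ler_nat card_prod -/m cardI leq_eqVlt; apply/orP; left.
  by apply/eqP; ring.
have typ := weight_typical mix_ge0 mix1 mixL diff1 mixd d0 dJ.
pose l : rat := 4 ^+ D / #|L|%:R ^+ #|{: W}|.
have Lpos : 0 < #|L|%:R :> rat by rewrite ltr0n.
have l0 : 0 < l by rewrite divr_gt0 ?exprn_gt0.
have sq_le : (\sum_t mix th t ^+ 2) ^+ #|{: W}| <= l.
  apply: le_trans (_ : ((1 + th ^+ 2 * #|L|%:R) / #|L|%:R) ^+ #|{: W}| <= _).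
    have S0 : 0 <= \sum_t mix th t ^+ 2 by apply: sumr_ge0 => t _; exact: sqr_ge0.
    rewrite lerXn2r ?nnegrE ?mix_sqr //; exact: le_trans S0 (mix_sqr th01).
  rewrite expr_div_n ler_pM2r ?invr_gt0 ?exprn_gt0 //.
  have -> : th ^+ 2 * #|L|%:R = D%:R / k%:R ^+ 2.
    by rewrite /th /D (natrM _ (_ ^ 2)) natrX expr_div_n mulrAC.
  set x := _ / _; have x0 : 0 <= x by rewrite divr_ge0 ?sqr_ge0.
  (* The exponent is split so that [2 D s^2] times [x] is 1/2: the inner power is at most 2, and its
     power [2 D] at most [4^D]. *)
  have -> : #|{: W}| = (2 * D * s ^ 2 * (2 * D))%N by rewrite cardI /k; ring.
  have -> : 4 ^+ D = 2 ^+ (2 * D) :> rat by rewrite exprM -natrX.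
  rewrite exprM lerXn2r ?nnegrE ?exprn_ge0 ?addr_ge0 //.
  have := expr1D_bernoulli (2 * D * s ^ 2) x0.
  have -> : (2 * D * s ^ 2)%:R * x = 2^-1.
    rewrite /x -natrX /k mulrA -natrM.
    have -> : (((2 * D * s) ^ 2) = 2 * (2 * D * s ^ 2 * D))%N by ring.
    rewrite [(2 * _)%:R]natrM invfM mulrCA divff ?mulr1 //.
    by rewrite pnatr_eq0 -lt0n !(muln_gt0, expn_gt0) m_gt0 N0_gt0 L_gt0 s0.
  by move: (_ ^+ _) => y; lra.
have muE M : #|{: W}|%:R * (th * (M / N0%:R)) = 2 * d * M.
  rewrite /th /d cardI natrX [(2 * m * k)%:R]natrM [(4 * m * N0)%:R]natrM.
  rewrite [(4 * m)%:R]natrM [(2 * m)%:R]natrM; field.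
  by rewrite N0_unit kneq0.
set good := [pred g : {ffun W -> T} | _].
have : 1 <= 2 * l * #|good|%:R.
  apply: (card_ge_of_weight l0 sq_le); apply: (le_trans typ).
  rewrite le_eqVlt; apply/orP; left; apply/eqP.
  apply: eq_bigl => g; rewrite inE; congr andb.
  by apply: eq_forallb => j; rewrite muE.
move: (#|good|%:R : rat) => B.
have Ln0 : 0 < #|L|%:R ^+ #|{: W}| :> rat by rewrite exprn_gt0.
rewrite -(ler_pM2r Ln0) mul1r => /le_trans; apply.
by rewrite mulrAC -(mulrA 2 l) /l divfK // gt_eqF.
Qed.
(** Different margins of [P] are integers at least 1 apart, so the windows of radius [d] around
    [2 d] times them are disjoint. Equal margins arise only from equal or diagonal pairs. *)
Lemma close_margins_order (W : {fset V}) d (g : {ffun W -> T}) (P' : profile X V) :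
  uniquely_weighted P -> 0 < d -> close_margins d g -> encodes P' g ->
  forall x y z w, x \in A -> y \in A -> z \in A -> w \in A ->
  (margin P x y < margin P z w) = (margin P' x y < margin P' z w).
Proof.
move=> uwP d0 /forallP close enc.
have near (x y : X) : x \in A -> y \in A ->
    `|(margin P' x y)%:~R - 2 * d * (margin P x y)%:~R : rat| < d.
  move=> xA yA; have := close ([` xA]%fset, [` yA]%fset).
  by rewrite /= -(encodes_margin _ _ enc).
have lt_margin x y z w : x \in A -> y \in A -> z \in A -> w \in A ->
    margin P x y < margin P z w -> margin P' x y < margin P' z w.
  move=> xA yA zA wA; rewrite -lezD1 -(ler_int rat) intrD.
  have := near x y xA yA; have := near z w zA wA; rewrite -(ltr_int rat).
  rewrite !ltr_norml; move: (_%:~R) (_%:~R) (_%:~R) (_%:~R) => a b a' b'.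
  by move=> /andP[? ?] /andP[? ?]; nra.
move=> x y z w xA yA zA wA; apply/idP/idP; first exact: lt_margin.
apply: contraTT; rewrite -!leNgt le_eqVlt => /orP[/eqP/esym eqm|]; last first.
  by move/(lt_margin _ _ _ _ zA wA xA yA)/ltW.
have [[-> ->]//|[-> ->]] := uniquely_weighted_eq uwP xA yA zA wA eqm.
by rewrite !margin_diag.
Qed.

Lemma asymptotic_uniquely_weighted (F : profile X V -> {fset X}) :
  infinite_type V -> ordinal_margin_invariant F -> asymptotically_resolvable F ->
  uniquely_weighted P -> (#|` F P| <= 1)%N.
Proof.
move=> infV oF rF uwP; rewrite leqNgt; apply/negP => gt1.
have [v v_inj] := infinite_type_inj infV.
(* If [F P] had two elements, at least this proportion of linear profiles would be unresolved for
   arbitrarily large electorates. *)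
have eps0 : 0 < (2 * 4 ^+ D)^-1 :> rat by rewrite invr_gt0 mulr_gt0 ?exprn_gt0.
have A0 : (0 < #|` A|)%N by rewrite cardfs_gt0 alts_neq0.
have [N] := rF _ A0 A erefl (initial v) (card_initial v_inj) _ eps0.
(* A size of the shape [card_close_margins] treats, with [s = N.+1] so that it is at least [N]. *)
pose n := ((2 * D * N.+1) ^ 2)%N; pose W := initial v n.
have D0 : (0 < D)%N by rewrite muln_gt0 expn_gt0 !muln_gt0 m_gt0 N0_gt0 L_gt0.
have leNn : (N <= n)%N by rewrite /n; move: D D0 => C; nia.
move=> /(_ _ leNn); apply/negP; rewrite -leNgt -/W.
have cardW : #|{: W}| = n by rewrite -cardfE card_initial.
have [d d0] := card_close_margins (ltn0Sn N) cardW.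
set good := [pred g | _] => le_good.
have W0 : W != fset0%fset.
  by rewrite -cardfs_gt0 card_initial // /n expn_gt0 muln_gt0 (muln_gt0 2) D0.
have le_lin : (num_linear_profiles (X := X) A W <= #|L| ^ #|{: W}|)%N.
  rewrite -card_ffun_on; apply: subset_leq_card; apply/subsetP => g.
  by rewrite inE => /asboolP[P' /encodes_linear].
have le_unres : (num_linear_unresolved F A W <= num_linear_profiles A W)%N.
  apply: subset_leq_card; apply/subsetP => g.
  by rewrite !inE => /asboolP[P' [enc _]]; apply/asboolP; exists P'.
(* A table with close margins encodes a profile with the margin order of [P], hence with the same
   set of winners. *)
have good_unres : (#|good| <= num_linear_unresolved F A W)%N.
  apply: subset_leq_card; apply/subsetP => g.
  rewrite !inE => /andP[gL close]; apply/asboolP.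
  have [P' enc] := encodes_ex (alts_neq0 P) W0 gL; exists P'; split=> //.
  rewrite -(margin_order_invariant oF _ (close_margins_order uwP d0 close enc)) //.
  by case: enc.
have Ln0 : 0 < (#|L| ^ #|{: W}|)%:R :> rat by rewrite ltr0n expn_gt0 L_gt0.
rewrite -natrX in le_good.
move: le_lin le_unres good_unres le_good Ln0; rewrite -!(ler_nat rat).
move: (num_linear_unresolved _ _ _)%:R (num_linear_profiles _ _)%:R => u l.
move: (#|good|%:R : rat) ((#|L| ^ _)%:R : rat) => b lw lin unres gu lg lw0.
move: eps0; rewrite invr_gt0; move: (2 * _ : rat) lg => e lg e0.
have u0 : 0 < u by apply: lt_le_trans gu; rewrite -(pmulr_rgt0 _ e0) (lt_le_trans lw0).
rewrite ler_pdivlMr ?(lt_le_trans u0) // ler_pdivrMl //.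
by rewrite (le_trans lin) // (le_trans lg) // ler_pM2l.
Qed.

End Asymptotic.

(** * Four alternatives *)

Section FourAlternatives.
Local Open Scope fset_scope.
Variables (X V : choiceType) (F : profile X V -> {fset X}).
Variables (alt : nat -> X) (alt_inj : injective alt).
Variables (v : nat -> V) (v_inj : injective v).
Hypotheses (vmF : voting_method F) (piF : positive_involvement F)
  (cwF : condorcet_winner_criterion F) (clF : condorcet_loser_criterion F)
  (omF : ordinal_margin_invariant F)
  (uwF : forall P, linear_profile P -> uniquely_weighted P -> #|` F P| <= 1).

Let A : {fset X} := initial alt 4.

Let mem_alt i : (alt i \in A) = (i < 4) := mem_initial alt_inj 4 i.

Let altP x : reflect (exists2 i, i < 4 & x = alt i) (x \in A) := initialP alt 4 x.

Definition prefers (i j : nat) (r : seq nat) := index i r < index j r.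

Definition ballot_rel (r : seq nat) (x y : X) : bool :=
  [&& x \in A, y \in A & index x (map alt r) < index y (map alt r)].

Lemma ballot_relE r i j : i < 4 -> j < 4 ->
  ballot_rel r (alt i) (alt j) = prefers i j r.
Proof.
by move=> ilt jlt; rewrite /ballot_rel !mem_alt ilt jlt !index_map.
Qed.

(** Comparing positions gives a strict weak order; alternatives missing from [r] all get position
    [size r] and tie at the bottom. *)
Lemma ballot_rel_good r : good_ballot A (ballot_rel r).
Proof.
split=> [x y /and3P[]//|]; rewrite /ballot_rel; split=> x y.
- by move=> -> -> /=; lia.
- by move=> z -> -> -> /=; lia.
- by move=> z -> -> -> /=; lia.
Qed.

Definition profile_of (l : seq (seq nat)) (P : profile X V) :=
  [/\ alts P = A, voters P = initial v (size l) &
    forall k, k < size l -> pref P (v k) = ballot_rel (nth [::] l k)].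

Lemma profile_ofP l : 0 < size l -> exists P, profile_of l P.
Proof.
move=> l0; have A0 : A != fset0 by apply/fset0Pn; exists (alt 0); rewrite mem_alt.
by have := enum_profile v_inj A0 l0 (fun k => ballot_rel_good (nth [::] l k)).
Qed.

Definition tally (l : seq (seq nat)) i j := count (prefers i j) l.

Lemma profile_of_support l P i j : profile_of l P -> i < 4 -> j < 4 ->
  Defs.support P (alt i) (alt j) = tally l i j.
Proof.
move=> [_ vP bP] ilt jlt; rewrite (enum_support v_inj _ _ vP bP) /tally -sum1_count.
rewrite [RHS]big_mkcond [RHS](big_nth [::]); apply: eq_bigr => k _.
by rewrite ballot_relE //; case: prefers.
Qed.

(* Margin of [i] over [j] below margin of [k] over [t], rearranged to avoid
   truncated subtraction. *)
Definition margin_lt l i j k t := tally l i j + tally l t k < tally l k t + tally l j i.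

Lemma profile_of_margin_lt l P i j k t : profile_of l P ->
  i < 4 -> j < 4 -> k < 4 -> t < 4 ->
  (margin P (alt i) (alt j) < margin P (alt k) (alt t))%R = margin_lt l i j k t.
Proof.
move=> lP ilt jlt klt tlt; rewrite /margin !(profile_of_support lP) //.
by rewrite /margin_lt; lia.
Qed.

Definition forall4 (p : pred nat) := all p (iota 0 4).

Lemma forall4P (p : pred nat) : reflect (forall i, i < 4 -> p i) (forall4 p).
Proof.
apply: (iffP allP) => H i; first by move=> ilt; apply: H; rewrite mem_iota.
by rewrite mem_iota => ilt; apply: H.
Qed.

Definition same_order l l' :=
  forall4 (fun i => forall4 (fun j => forall4 (fun k => forall4 (fun t =>
    margin_lt l i j k t == margin_lt l' i j k t)))).

Definition top i r := forall4 (fun j => (j == i) || prefers i j r).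

(** The pair [c c] stands for the margin 0. *)
Definition cond_winner c l := forall4 (fun j => (j == c) || margin_lt l c c c j).

Definition cond_loser c l := forall4 (fun j => (j == c) || margin_lt l c c j c).

Definition linear_ballot (r : seq nat) := forall4 (fun i => i \in r).

Definition distinct_margins l :=
  forall4 (fun i => forall4 (fun j => forall4 (fun k => forall4 (fun t =>
    [|| i == j, k == t, (i == k) && (j == t), margin_lt l i j k t
      | margin_lt l k t i j])))).

Definition wins i l := exists2 P, profile_of l P & alt i \in F P.

Lemma wins_lt4 i l : wins i l -> i < 4.
Proof.
move=> [P [aP _ _] iF]; rewrite -mem_alt -aP.
by have [/fsubsetP/(_ _ iF)] := vmF P.
Qed.

Lemma profile_of_order l l' P P' : profile_of l P -> profile_of l' P' ->
  same_order l l' -> F P = F P'.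
Proof.
move=> lP lP' ll'; apply: margin_order_invariant => //.
  by case: lP => -> _ _; case: lP' => ->.
case: (lP) => -> _ _ x y z w /altP[i ilt ->] /altP[j jlt ->] /altP[k klt ->].
move=> /altP[t tlt ->].
rewrite (profile_of_margin_lt lP) // (profile_of_margin_lt lP') //.
by move: ll' => /forall4P/(_ _ ilt)/forall4P/(_ _ jlt)/forall4P/(_ _ klt)
  /forall4P/(_ _ tlt)/eqP.
Qed.

Lemma wins_order i l l' : 0 < size l' -> same_order l l' -> wins i l -> wins i l'.
Proof.
move=> l'0 ll' [P lP iF]; have [P' lP'] := profile_ofP l'0.
by exists P' => //; rewrite -(profile_of_order lP lP' ll').
Qed.

Lemma wins_cat i l e : all (top i) e -> wins i l -> wins i (l ++ e).
Proof.
elim/last_ind: e => [|e r IHe]; first by rewrite cats0.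
rewrite all_rcons => /andP[topr /IHe{}IHe] /IHe il.
have ilt := wins_lt4 il; case: il => P lP iF; rewrite -rcons_cat.
set m := l ++ e in lP *.
have [P' lP'] : exists P', profile_of (rcons m r) P'.
  by apply: profile_ofP; rewrite size_rcons.
exists P' => //; case: lP => aP vP bP; case: lP' => aP' vP' bP'.
apply: (piF (j := v (size m)) iF).
  split=> //; last 1 first.
  - move=> j jm; apply/funext => x; apply/funext => y.
    have prefF Q : j \notin voters Q -> pref Q j x y = false.
      move=> jQ; apply/negP; case: (proj2_sig Q) => _ _ H _ /H[jQ' _ _].
      by rewrite jQ' in jQ.
    have [|jP'] := boolP (j \in voters P'); last first.
      rewrite !prefF //; apply: contraNN jP'; rewrite vP vP'.
      move=> /initialP[k klt ->]; rewrite mem_initial // size_rcons; lia.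
    rewrite vP' => /initialP[k]; rewrite size_rcons => klt ek.
    have ltk : k < size m.
      have : k != size m by apply: contraNneq jm => <-; rewrite ek.
      lia.
    by rewrite ek bP // bP' ?nth_rcons ?ltk // size_rcons ltnW.
  - by rewrite vP mem_initial // ltnn.
  - rewrite vP vP' size_rcons; apply/fsetP => j; rewrite in_fset1U.
    apply/initialP/orP => [[k]|[/eqP ->|/initialP[k klt ->]]].
    + rewrite ltnS leq_eqVlt => /orP[/eqP ->|klt] ->; first by left.
      by right; rewrite mem_initial.
    + by exists (size m).
    + by exists k => //; rewrite ltnW.
  - by rewrite aP.
move=> y; rewrite aP => /altP[j jlt ->] ji.
rewrite bP' ?size_rcons // nth_rcons ltnn eqxx ballot_relE //.
move: topr => /forall4P/(_ _ jlt)/orP[/eqP eji|//].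
by rewrite eji eqxx in ji.
Qed.

Lemma wins_cond_winner i c l : c < 4 -> cond_winner c l -> wins i l -> i = c.
Proof.
move=> clt /forall4P cwl [P lP]; have [aP _ _] := lP.
rewrite (cwF (x := alt c)) ?in_fset1; first by move=> /eqP/alt_inj.
split=> [|y]; rewrite aP ?mem_alt // => /altP[j jlt ->] jc.
rewrite -(margin_diag P (alt c)) (profile_of_margin_lt lP) //.
by have /orP[/eqP ejc|//] := cwl _ jlt; rewrite ejc eqxx in jc.
Qed.

Lemma cond_loser_not_wins c l : cond_loser c l -> ~ wins c l.
Proof.
move=> /forall4P cll cw; have clt := wins_lt4 cw; case: cw => P lP.
have [aP _ _] := lP; apply/negP/clF; split; first by rewrite aP mem_alt.
  exists (alt (c == 0)); rewrite aP mem_alt; split; first by case: (c == 0).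
  by rewrite (inj_eq alt_inj); case: (c).
move=> y; rewrite aP // => /altP[j jlt ->] jc.
rewrite -(margin_diag P (alt c)) (profile_of_margin_lt lP) //.
by have /orP[/eqP ejc|//] := cll _ jlt; rewrite ejc eqxx in jc.
Qed.

Lemma wins_ex l : 0 < size l -> exists2 i, i < 4 & wins i l.
Proof.
move=> /profile_ofP[P lP]; have [aP _ _] := lP.
have [/fsubsetP FA /fset0Pn[x xF]] := vmF P.
have := FA _ xF; rewrite aP => /altP[i ilt xi]; exists i => //.
by exists P => //; rewrite -xi.
Qed.

(** Ordinal margin invariance places both wins in one profile of [l], which is linear and uniquely
    weighted. *)
Lemma wins_unique i j l : 0 < size l ->
  all linear_ballot l -> distinct_margins l -> wins i l -> wins j l -> i = j.
Proof.
move=> l0 linl dl [P lP iF] [P' lP' jF].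
have {P' lP'}jF : alt j \in F P.
  rewrite (profile_of_order lP lP') //.
  by do 4![apply/forall4P => ? _].
have [aP vP bP] := lP.
have : #|` F P| <= 1.
  apply: uwF.
    move=> k kP; split; first by case: (pref_good kP).
    move: kP; rewrite vP => /initialP[n nlt ->].
    rewrite aP => x y /altP[a alt4 ->] /altP[b blt4 ->].
    rewrite (inj_eq alt_inj) bP // !ballot_relE // /prefers => ab.
    have /forall4P linr : linear_ballot (nth [::] l n).
      exact: (allP linl) (mem_nth _ _).
    rewrite -neq_ltn; apply: contraNneq ab => eab; apply/eqP.
    exact: index_inj (linr _ alt4) (linr _ blt4) eab.
  rewrite /uniquely_weighted aP.
  move=> x y z w /altP[a alt4 ->] /altP[b blt ->] /altP[c clt ->] /altP[d dlt ->].
  rewrite !(inj_eq alt_inj) => /negPf ab /negPf cd eqm.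
  move: dl => /forall4P/(_ _ alt4)/forall4P/(_ _ blt)/forall4P/(_ _ clt)
    /forall4P/(_ _ dlt).
  rewrite ab cd -!(profile_of_margin_lt lP) // eqm ltxx !orbF /=.
  by move=> /andP[/eqP -> /eqP ->].
move=> F1; apply: alt_inj; apply/eqP/negPn/negP => ij.
move: F1; rewrite leqNgt => /negP; apply.
have -> : 2 = #|` [fset alt i; alt j]| by rewrite cardfs2 ij.
by apply: fsubset_leq_card; apply/fsubsetP => x; rewrite in_fset2 => /orP[]/eqP->.
Qed.

(* Every edge (u, v, w) contributes 2w to the margin of u over v and nothing to
   any other margin (McGarvey's construction). *)
Definition mcgarvey (edges : seq (nat * nat * nat)) : seq (seq nat) :=
  flatten [seq let: (u, v, w) := e in
    let rest := filter (predC (mem [:: u; v])) (iota 0 4) in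
    nseq w (u :: v :: rest) ++ nseq w (rev rest ++ [:: u; v]) | e <- edges].

Definition weigh (edges : seq (nat * nat)) (ws : seq nat) := mcgarvey (zip edges ws).

(* Margin graphs are given by their edges from largest to smallest margin. *)
Definition graph (edges : seq (nat * nat)) := weigh edges [:: 6; 5; 4; 3; 2; 1].

(* [ws] realizes the same ordinal margin graph with margins spread so that the
   ballots [e] produce the one of [l]; such [ws] and [e] were found by search. *)
Lemma wins_add i es ws e l :
  [&& 0 < size l, 0 < size (weigh es ws), same_order (graph es) (weigh es ws),
      all (top i) e & same_order (weigh es ws ++ e) l] ->
  wins i (graph es) -> wins i l.
Proof.
move=> /and5P[l0 w0 ew tope wel] /(wins_order w0 ew)/(wins_cat tope).
exact: wins_order.
Qed.

(** If [i] won, it would keep winning after [e] is added, although [c] is then the Condorcet winner.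
    In the uses below, the number of ballots lies strictly between the largest margin against [c]
    and the margin of [c] over [i]: every defeat of [c] is reversed while [c] still beats [i]. *)
Lemma not_wins_add i c es e :
  [&& c < 4, c != i, all (top i) e & cond_winner c (graph es ++ e)] ->
  ~ wins i (graph es).
Proof.
move=> /and4P[clt ci tope cw] /(wins_cat tope)/(wins_cond_winner clt cw) eic.
by rewrite eic eqxx in ci.
Qed.

(** * Five margin graphs and the contradiction *)

Let a := 0. Let b := 1. Let c := 2. Let d := 3.

(** All five contain the cycle [a] over [b] over [c] over [a], and [a] and [c] beat [d]. They differ
    in the ranking of the margins, and only in [G1] does [b] beat [d], which makes [d] a Condorcet
    loser there. *)
Let G0 := [:: (a, b); (c, a); (b, c); (a, d); (d, b); (c, d)].
Let G1 := [:: (b, c); (a, b); (c, a); (a, d); (c, d); (b, d)].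
Let G1' := [:: (b, c); (a, b); (c, a); (a, d); (d, b); (c, d)].
Let G2 := [:: (c, a); (b, c); (a, b); (d, b); (a, d); (c, d)].
Let G3 := [:: (c, a); (a, b); (b, c); (d, b); (a, d); (c, d)].

(** In [G1] only [a] can win: [b] and [c] are excluded by adding ballots and [d] is the Condorcet
    loser. Ballots topped by [a] then reverse the edge from [b] to [d] and lead to [G1']. *)
Lemma wins_G1' i : wins i (graph G1') -> i = a.
Proof.
suff a1 : wins a (graph G1').
  by move=> ?; apply: (@wins_unique i a (graph G1')) => //; vm_compute.
apply: (@wins_add _ G1 [:: 12; 10; 9; 3; 2; 1]
  ([:: a; c; d; b] :: nseq 4 [:: a; d; b; c])); first by vm_compute.
have [i' i4 iw] : exists2 i, i < 4 & wins i (graph G1) by apply: wins_ex.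
case: i' i4 iw => [|[|[|[|//]]]] // _ iw; exfalso; move: iw.
- by apply: (@not_wins_add _ a _
      ([:: b; a; c; d] :: nseq 8 [:: b; a; d; c])); vm_compute.
- by apply: (@not_wins_add _ b _
      ([:: c; b; a; d] :: nseq 10 [:: c; b; d; a])); vm_compute.
- by apply: cond_loser_not_wins; vm_compute.
Qed.

(** In [G2] adding ballots excludes [a], [b] and [c], so [d] wins. Ballots topped by [d] swap the
    ranks of [(b, c)] and [(a, b)], which gives [G3]. *)
Lemma wins_G3 i : wins i (graph G3) -> i = d.
Proof.
suff d3 : wins d (graph G3).
  by move=> ?; apply: (@wins_unique i d (graph G3)) => //; vm_compute.
apply: (@wins_add _ G2 [:: 8; 7; 6; 4; 3; 2]
  [:: [:: d; a; c; b]; [:: d; c; a; b]]); first by vm_compute.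
have [i' i4 iw] : exists2 i, i < 4 & wins i (graph G2) by apply: wins_ex.
case: i' i4 iw => [|[|[|[|//]]]] // _ iw; exfalso; move: iw.
- by apply: (@not_wins_add _ c _
      ([:: a; c; b; d] :: nseq 10 [:: a; c; d; b])); vm_compute.
- by apply: (@not_wins_add _ d _
      ([:: b; c; d; a] :: nseq 4 [:: b; d; a; c])); vm_compute.
- by apply: (@not_wins_add _ b _
      ([:: c; b; a; d] :: nseq 8 [:: c; b; d; a])); vm_compute.
Qed.

(** In [G0] adding ballots excludes [a] and [b]. A win of [c] would carry over to [G3], where only
    [d] wins, and a win of [d] to [G1'], where only [a] wins. *)
Lemma four_alternatives_impossibility : False.
Proof.
have [i i4 iw] : exists2 i, i < 4 & wins i (graph G0) by apply: wins_ex.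
case: i i4 iw => [|[|[|[|//]]]] // _ iw.
- move: iw; apply: (@not_wins_add _ c _ ([:: a; c; b; d] :: nseq 8 [:: a; c; d; b])).
  by vm_compute.
- move: iw; apply: (@not_wins_add _ a _ ([:: b; a; c; d] :: nseq 10 [:: b; a; d; c])).
  by vm_compute.
- suff /wins_G3 : wins c (graph G3) by [].
  by apply: (@wins_add _ G0 [:: 8; 7; 6; 4; 3; 1]
      (nseq 2 [:: c; d; b; a])) iw; vm_compute.
- suff /wins_G1' : wins d (graph G1') by [].
  by apply: (@wins_add _ G0 [:: 10; 9; 8; 7; 3; 2]
      (nseq 3 [:: d; b; a; c])) iw; vm_compute.
Qed.

End FourAlternatives.

Theorem theorem1 (X V : choiceType)
  (hX : infinite_type X) (hV : infinite_type V) :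
  (forall F : profile X V -> {fset X},
     voting_method F -> positive_involvement F ->
     condorcet_winner_criterion F -> condorcet_loser_criterion F ->
     single_voter_resolvable F -> ordinal_margin_invariant F -> False) /\
  (forall F : profile X V -> {fset X},
     voting_method F -> positive_involvement F ->
     condorcet_winner_criterion F -> condorcet_loser_criterion F ->
     asymptotically_resolvable F -> ordinal_margin_invariant F -> False).
Proof.
have [alt alt_inj] := infinite_type_inj hX.
have [v v_inj] := infinite_type_inj hV.
split=> F vmF piF cwF clF rF omF;
  apply: (four_alternatives_impossibility alt_inj v_inj vmF piF cwF clF omF)
    => P linP uwP.
  exact: single_voter_uniquely_weighted.
exact: asymptotic_uniquely_weighted.
Qed.
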